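(* Let $X,Y$ be metric spaces, let $E,F$ be normed spaces over $\mathbb{K}$, and let $A(X,E)\subset C(X,E)$, $A(X)\subset C(X)$ and $A(Y,F)\subset C(Y,F)$, $A(Y)\subset C(Y)$ be such that the pairs $(A(X,E),A(X))$ and $(A(Y,F),A(Y))$ are admissible. Let $T:A(X,E)\rightarrow A(Y,F)$ be a linear and bijective map that preserves common zeros. Then there exist a homeomorphism $h:Y\rightarrow X$ and, for each $y\in Y$, $\mathbb{K}$-normed subspaces $E_y\subset E$ and $F_y\subset F$ and a linear and bijective map $J_y:E_y\rightarrow F_y$, such that $$Tf(y)=J_y(f(h(y)))$$ for all $f\in A(X,E)$ and $y\in Y$ (in particular, $f(h(y))\in E_y$ for all such $f$ and $y$, so that the right-hand side makes sense).
   Context: $\mathbb{K}$ is $\mathbb{R}$ or $\mathbb{C}$. For a metric space $X$ and a $\mathbb{K}$-normed space $E$, $C(X,E)$ is the space of all continuous functions $X\to E$, and $C(X)=C(X,\mathbb{K})$. For $f:X\to E$, $Z(f)=\{x\in X: f(x)=0\}$. A function $f$ is non-vanishing if $Z(f)=\emptyset$. Call a pair $(A(X,E),A(X))$ admissible if $A(X,E)$ is a vector subspace of $C(X,E)$, $A(X)$ is a subring of $C(X)$, and: (1) $A(X,E)$ contains non-vanishing functions; (2) $A(X,E)$ is an $A(X)$-module: if $f\in A(X)$ and $g\in A(X,E)$ then the pointwise product $f\cdot g\in A(X,E)$; (3) for each $x_0\in X$ there exists $f_{x_0}\in A(X,E)$ with $Z(f_{x_0})=\{x_0\}$; (4) $A(X)$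 is completely regular: for every $x_0\in X$ and every closed $C\subset X$ with $x_0\notin C$ there exists $\varphi\in A(X)$ with $\varphi(x_0)=1$ and $\varphi\equiv 0$ on $C$. Admissibility of $(A(Y,F),A(Y))$ is defined in the same way. A linear map $T:A(X,E)\to A(Y,F)$ preserves common zeros if, for all $f,g\in A(X,E)$, $Z(f)\cap Z(g)\neq\emptyset \Longleftrightarrow Z(Tf)\cap Z(Tg)\neq\emptyset$. *)

(* Defs.v *)
From HB Require Import structures.
From mathcomp Require Import all_boot all_order all_algebra.
From mathcomp Require Import complex.
From mathcomp Require Import boolp classical_sets functions reals.
From mathcomp Require Import topology normedtype.

Set Implicit Arguments.
Unset Strict Implicit.
Unset Printing Implicit Defensive.

Import Order.TTheory GRing.Theory Num.Theory.
Import numFieldNormedType.Exports.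

Local Open Scope classical_set_scope.
Local Open Scope ring_scope.

Definition real_or_complex (R : realType) (K : numFieldType) : Prop :=
  K = R :> numFieldType \/ K = R[i] :> numFieldType.

Definition zero_set (X : Type) (V : nmodType) (f : X -> V) : set X :=
  [set x | f x = 0].

Definition linear_subspace (K : pzRingType) (V : lmodType K)
    (A : set V) : Prop :=
  submod_closed [in A].

(* No unit is required, which covers both conventions for subrings. *)
Definition is_subring (S : pzRingType) (A : set S) : Prop :=
  zmod_closed [in A] /\ GRing.mulr_2closed [in A].

(* A linear map defined on a subspace [A] of [U] is represented by a total
   function on [U], whose values outside of [A] are irrelevant. *)
Definition linear_on (K : pzRingType) (U V : lmodType K) (A : set U)
    (f : U -> V) : Prop :=
  forall (a : K) (u v : U), A u -> A v -> f (a *: u + v) = a *: f u + f v.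

Definition completely_regular (X : topologicalType) (K : numFieldType)
    (AX : set (X -> K)) : Prop :=
  forall (x0 : X) (C : set X), closed C -> ~ C x0 ->
    exists phi : X -> K,
      [/\ AX phi, phi x0 = 1 & forall x, C x -> phi x = 0].

Record admissible (R : realType) (K : numFieldType) (X : metricType R)
    (E : normedModType K) (AXE : set (X -> E)) (AX : set (X -> K)) : Prop := {
  admissible_continuousE : forall f, AXE f -> continuous f;
  admissible_subspace : linear_subspace AXE;
  admissible_continuous : forall f, AX f -> continuous f;
  admissible_subring : is_subring AX;
  admissible_nonvanishing : exists2 f, AXE f & zero_set f = set0;
  admissible_module : forall (f : X -> K) (g : X -> E),
    AX f -> AXE g -> AXE (fun x => f x *: g x);
  admissible_single_zero : forall x0 : X,
    exists2 f, AXE f & zero_set f = [set x0];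
  admissible_completely_regular : completely_regular AX
}.

Definition preserves_common_zeros (X Y : Type) (V W : nmodType)
    (A : set (X -> V)) (T : (X -> V) -> (Y -> W)) : Prop :=
  forall f g : X -> V, A f -> A g ->
    (zero_set f `&` zero_set g !=set0 <->
     zero_set (T f) `&` zero_set (T g) !=set0).

Definition homeomorphism (X Y : topologicalType) (h : X -> Y) : Prop :=
  continuous h /\
  exists k : Y -> X, [/\ continuous k, cancel h k & cancel k h].

(* Main.v *)
(* Let [f_x] have the single zero [x].  If [Z(T f_x)] contained two points
   [y] and [y'], then the [T]-preimages of functions vanishing only at [y],
   resp. [y'], would both vanish at [x], contradicting the preservation of
   common zeros; so [Z(T f_x)] is a point [k x], and [f x = 0] iff
   [T f (k x) = 0].  The inverse [h] of [k] arises by symmetry.  Since zero sets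
   form a base of closed sets (multiply a non-vanishing function by the [phi] of
   complete regularity) and [h] and [k] exchange them, [h] is a homeomorphism.
   Finally, evaluation at [h y] and [f |-> T f y] are linear maps with the same
   kernel, so the latter factors through the former. *)

Require Import Defs.
From mathcomp Require Import all_boot all_order all_algebra.
From mathcomp Require Import complex.
From mathcomp Require Import boolp classical_sets functions reals.
From mathcomp Require Import topology normedtype.

Set Implicit Arguments.
Unset Strict Implicit.
Unset Printing Implicit Defensive.

Import Order.TTheory GRing.Theory Num.Theory.
Import numFieldNormedType.Exports.

Local Open Scope classical_set_scope.
Local Open Scope ring_scope.

(** A closed-base condition: every closed set is the intersection of the [z i], with [i] in [D],
    that contain it. *)
Definition separates_points_closed (I : Type) (X : topologicalType)
    (D : set I) (z : I -> set X) : Prop :=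
  forall (C : set X) (x : X), closed C -> ~ C x ->
    exists i, [/\ D i, C `<=` z i & ~ z i x].

(** Replacing functions by indices of sets makes the hypotheses symmetric in [X] and [Y], so the
    same argument yields both [k] and its inverse. *)
Lemma set_family_transfer (I X Y : Type) (D : set I)
    (zX : I -> set X) (zY : I -> set Y) :
  (forall i j, D i -> D j ->
     (zX i `&` zX j !=set0 <-> zY i `&` zY j !=set0)) ->
  (forall x, exists2 i, D i & zX i = [set x]) ->
  (forall y, exists2 i, D i & zY i = [set y]) ->
  exists k : X -> Y, forall i x, D i -> (zX i x <-> zY i (k x)).
Proof.
move=> meetE singX singY.
suff pointwise x : exists y, forall i, D i -> (zX i x <-> zY i y).
  have [k kP] := choice pointwise.
  by exists k => i x; exact: kP.
have [i Di zXi] := singX x.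
have meetx j : D j -> (zX j x <-> zY j `&` zY i !=set0).
  move=> Dj; rewrite -meetE // zXi; split; first by exists x.
  by case=> t [zjt /= <-].
have [y [zYiy _]] : zY i `&` zY i !=set0 by apply/meetx => //; rewrite zXi.
exists y => j Dj; rewrite meetx //; split; last by exists y.
(* It remains to identify [y'] with [y]: the sets on the [X] side whose partners are the singletons
   of [y] and [y'] both contain [x]. *)
case=> y' [zYjy' zYiy'].
have [l Dl zYl] := singY y; have [l' Dl' zYl'] := singY y'.
have zXl : zX l x by apply/meetx => //; exists y; rewrite zYl.
have zXl' : zX l' x by apply/meetx => //; exists y'; rewrite zYl'.
have [w] : zY l `&` zY l' !=set0 by apply/meetE => //; exists x.
by rewrite zYl zYl' => -[/= <- ->].
Qed.

(** A closed set is an intersection of sets [zX i], and [h] pulls each of these back to the closed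
    set [zY i]. *)
Lemma continuous_closed_family (I : Type) (X Y : topologicalType) (D : set I)
    (zX : I -> set X) (zY : I -> set Y) (h : Y -> X) :
  separates_points_closed D zX ->
  (forall i, D i -> closed (zY i)) ->
  (forall i y, D i -> (zX i (h y) <-> zY i y)) ->
  continuous h.
Proof.
move=> sepX closedY hP; apply/continuousP => U openU.
rewrite -closedC.
have -> : ~` (h @^-1` U) = \bigcap_(i in [set i | D i /\ ~` U `<=` zX i]) zY i.
  apply/seteqP; split=> y /=.
    by move=> nUhy i [Di Uzi]; apply/hP => //; exact: Uzi.
  move=> zYy Uhy.
  have [i [Di Uzi]] := sepX (~` U) (h y) (open_closedC openU) (fun H => H Uhy).
  by apply; apply/hP => //; exact: zYy.
by apply: closed_bigI => i [Di _]; exact: closedY.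
Qed.

Lemma homeomorphism_of_set_families (I : Type) (X Y : topologicalType)
    (D : set I) (zX : I -> set X) (zY : I -> set Y) :
  (forall i j, D i -> D j ->
     (zX i `&` zX j !=set0 <-> zY i `&` zY j !=set0)) ->
  (forall x, exists2 i, D i & zX i = [set x]) ->
  (forall y, exists2 i, D i & zY i = [set y]) ->
  (forall i, D i -> closed (zX i)) ->
  (forall i, D i -> closed (zY i)) ->
  separates_points_closed D zX -> separates_points_closed D zY ->
  exists h : Y -> X, homeomorphism h /\
    forall i y, D i -> (zX i (h y) <-> zY i y).
Proof.
move=> meetE singX singY closedX closedY sepX sepY.
have [k kP] := set_family_transfer meetE singX singY.
have [|h hP] := @set_family_transfer I Y X D zY zX _ singY singX.
  by move=> i j Di Dj; rewrite meetE.
have kP' i x (Di : D i) := iff_sym (kP i x Di).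
have hP' i y (Di : D i) := iff_sym (hP i y Di).
exists h; split=> //; split; first exact: continuous_closed_family hP'.
exists k; split; first exact: continuous_closed_family kP'.
(* Both maps respect membership in the family, so [k (h y)] lies in the member that is the singleton
   of [y]. *)
- move=> y; have [i Di zYi] := singY y.
  by have : zY i (k (h y)); [apply/kP => //; apply/hP => //|]; rewrite zYi.
- move=> x; have [i Di zXi] := singX x.
  by have : zX i (h (k x)); [apply/hP => //; apply/kP => //|]; rewrite zXi.
Qed.

Lemma closed_zero_set (K : numFieldType) (X : topologicalType)
    (E : normedModType K) (f : X -> E) :
  continuous f -> closed (zero_set f).
Proof.
move=> cf; apply: (@preimage_closed _ _ f [set 0]) => //.
exact/accessible_closed_set1/hausdorff_accessible/norm_hausdorff.
Qed.

Lemma admissible_separates (R : realType) (K : numFieldType) (X : metricType R)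
    (E : normedModType K) (AXE : set (X -> E)) (AX : set (X -> K)) :
  admissible AXE AX ->
  separates_points_closed AXE (fun f : X -> E => zero_set f).
Proof.
move=> adm C x closedC nCx.
have [phi [AXphi phix phiC]] := admissible_completely_regular adm closedC nCx.
have [g Ag zg] := admissible_nonvanishing adm.
exists (fun t => phi t *: g t); split; first exact: (admissible_module adm).
- by move=> t Ct; rewrite /zero_set /= phiC // scale0r.
- rewrite /zero_set /= phix scale1r => gx0.
  by have : zero_set g x by []; rewrite zg.
Qed.

Lemma linear_subspaceP (K : pzRingType) (V : lmodType K) (A : set V) :
  linear_subspace A <->
  A 0 /\ (forall (a : K) u v, A u -> A v -> A (a *: u + v)).
Proof.
split=> [[A0 Alin]|[A0 Alin]].
  split=> [|a u v Au Av]; first by move: A0; rewrite inE.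
  by have := Alin a u v; rewrite !inE; exact.
by split=> [|a u v]; rewrite !inE //; exact: Alin.
Qed.

Lemma linear_subspace_image (K : pzRingType) (U V : lmodType K) (A : set U)
    (f : U -> V) :
  linear_subspace A -> linear_on A f -> linear_subspace (f @` A).
Proof.
move=> /linear_subspaceP[A0 Alin] linf; apply/linear_subspaceP; split.
  exists 0 => //.
  (* Cancellation in [f 0 = f 0 + f 0]. *)
  by have := linf 1 0 0 A0 A0; rewrite !scale1r addr0 -{1}[f 0]addr0 => /addrI <-.
move=> a _ _ [u Au <-] [v Av <-].
by exists (a *: u + v); [exact: Alin | rewrite linf].
Qed.

(** Equal kernels on [A] give [p] and [q] the same fibres on [A]: one inclusion makes [J] well
    defined, the other makes it injective. *)
Lemma linear_factor (K : pzRingType) (U V W : lmodType K) (A : set U)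
    (p : U -> V) (q : U -> W) :
  linear_subspace A -> linear_on A p -> linear_on A q ->
  (forall u, A u -> (p u = 0 <-> q u = 0)) ->
  exists J : V -> W, [/\ linear_on (p @` A) J, set_bij (p @` A) (q @` A) J &
    forall u, A u -> q u = J (p u)].
Proof.
move=> /linear_subspaceP[_ Alin] linp linq pq0.
have pqE u v : A u -> A v -> (p u = p v <-> q u = q v).
  move=> Au Av; have := pq0 _ (Alin (-1) v u Av Au).
  rewrite linp // linq // !scaleN1r !(addrC (- _)).
  by rewrite !(rwP eqP) !subr_eq0.
(* Off the image of [p] the condition on [w] is vacuous, and [0] serves as a default value. *)
have /choice[J JP] e : exists w, forall u, A u -> p u = e -> q u = w.
  have [[v Av <-]|nAe] := pselect ((p @` A) e).
    by exists (q v) => u Au; exact: (pqE _ _ Au Av).1.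
  by exists 0 => u Au pue; case: nAe; exists u.
have qJ u : A u -> q u = J (p u) by move=> Au; exact: JP.
exists J; split=> //.
- move=> a _ _ [u Au <-] [v Av <-].
  by rewrite -linp // -!qJ ?linq //; exact: Alin.
- split.
  + by move=> _ [u Au <-]; exists u => //; exact: qJ.
  + move=> _ _ /set_mem[u Au <-] /set_mem[v Av <-]; rewrite -!qJ //.
    exact: (pqE _ _ Au Av).2.
  + by move=> _ [u Au <-]; exists (p u); [exists u | rewrite qJ].
Qed.

Theorem theorem3p1 (R : realType) (K : numFieldType)
    (hK : real_or_complex R K)
    (X Y : metricType R) (E F : normedModType K)
    (AXE : set (X -> E)) (AX : set (X -> K))
    (AYF : set (Y -> F)) (AY : set (Y -> K))
    (admX : admissible AXE AX) (admY : admissible AYF AY)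
    (T : (X -> E) -> (Y -> F))
    (linT : linear_on AXE T) (bijT : set_bij AXE AYF T)
    (zeroT : preserves_common_zeros AXE T) :
  exists h : Y -> X, homeomorphism h /\
    forall y : Y, exists (Ey : set E) (Fy : set F) (J : E -> F),
      [/\ linear_subspace Ey, linear_subspace Fy, linear_on Ey J, set_bij Ey Fy J &
          forall f : X -> E, AXE f ->
            Ey (f (h y)) /\ T f y = J (f (h y))].
Proof.
have [Tfun _ Tsurj] := bijT.
have subX := admissible_subspace admX.
(* The index set is [AXE] itself; surjectivity of [T] lets the functions [T f] stand for all of
   [AYF]. *)
have [|||||||h [homh hP]] := @homeomorphism_of_set_families (X -> E) X Y AXE
  (fun f => zero_set f) (fun f => zero_set (T f)).
- exact: zeroT.
- exact: admissible_single_zero admX.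
- move=> y; have [g /Tsurj[f Af <-] zg] := admissible_single_zero admY y.
  by exists f.
- by move=> f /(admissible_continuousE admX); exact: closed_zero_set.
- by move=> f /Tfun /(admissible_continuousE admY); exact: closed_zero_set.
- exact: admissible_separates admX.
- move=> C y closedC nCy.
  have [g [/Tsurj[f Af <-] Cg gy]] := admissible_separates admY closedC nCy.
  by exists f.
exists h; split=> // y.
have lin_eval : linear_on AXE (fun f => f (h y)) by [].
have lin_evalT : linear_on AXE (fun f => T f y).
  by move=> a f g Af Ag; rewrite linT.
(* At a fixed [y], [hP] says exactly that the two evaluations have the same kernel; their images
   serve as [Ey] and [Fy]. *)
have [J [linJ bijJ TJ]] := linear_factor subX lin_eval lin_evalT (hP^~ y).
exists ((fun f => f (h y)) @` AXE), ((fun f => T f y) @` AXE), J; split=> //.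
- exact: linear_subspace_image.
- exact: linear_subspace_image.
- by move=> f Af; split; [exists f | exact: TJ].
Qed.
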